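(* Consider the multinomial logistic model $\mathbf C^T\log(\mathbf L\boldsymbol\pi_i)=\mathbf X_i\boldsymbol\theta$, $i=1,\dots,m$ (see context), with independent observations. Then the Fisher information matrix of $\boldsymbol\theta$ is $$\mathbf F=\sum_{i=1}^m n_i\mathbf F_i,\qquad \mathbf F_i=\Big(\frac{\partial\boldsymbol\pi_i}{\partial\boldsymbol\theta^T}\Big)^T{\rm diag}(\boldsymbol\pi_i)^{-1}\frac{\partial\boldsymbol\pi_i}{\partial\boldsymbol\theta^T},$$ where $\dfrac{\partial\boldsymbol\pi_i}{\partial\boldsymbol\theta^T}=(\mathbf C^T\mathbf D_i^{-1}\mathbf L)^{-1}\mathbf X_i$ and $\mathbf D_i={\rm diag}(\mathbf L\boldsymbol\pi_i)$.
   Context: Let $d\ge 1$, $m\ge 2$, $J\ge 2$ be integers, $\mathbf x_1,\dots,\mathbf x_m\in\mathbb R^d$ distinct experimental settings, and $n_1,\dots,n_m\ge 0$ integers with $n=\sum_i n_i>0$. For each $i$ with $n_i>0$ one observes $\mathbf Y_i=(Y_{i1},\dots,Y_{iJ})^T\sim{\rm Multinomial}(n_i;\pi_{i1},\dots,\pi_{iJ})$, independently over $i$; write $\boldsymbol\pi_i=(\pi_{i1},\dots,\pi_{iJ})^T$, $\sum_j\pi_{ij}=1$. Model. Known functions $\mathbf h_j$ with values in $\mathbb R^{p_j}$ ($j=1,\dots,J-1$) and $\mathbf h_c$ with values in $\mathbb R^{p_c}$ are given; the parameter is $\boldsymbol\theta=(\boldsymbol\beta_1^T,\dots,\boldsymbol\beta_{J-1}^T,\boldsymbol\zeta^T)^T\in\mathbb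 R^p$ with $\boldsymbol\beta_j\in\mathbb R^{p_j}$, $\boldsymbol\zeta\in\mathbb R^{p_c}$, $p=p_1+\dots+p_{J-1}+p_c$. ($p_c=0$, i.e. no $\mathbf h_c,\boldsymbol\zeta$, is allowed.) For one fixed choice among four logit types, $\log(\nu_{ij}/\delta_{ij})=\mathbf h_j^T(\mathbf x_i)\boldsymbol\beta_j+\mathbf h_c^T(\mathbf x_i)\boldsymbol\zeta$ for $j=1,\dots,J-1$, where $(\nu_{ij},\delta_{ij})$ is: $(\pi_{ij},\pi_{iJ})$ (baseline-category); $(\pi_{i1}+\dots+\pi_{ij},\ \pi_{i,j+1}+\dots+\pi_{iJ})$ (cumulative); $(\pi_{ij},\pi_{i,j+1})$ (adjacent-categories); $(\pi_{ij},\ \pi_{i,j+1}+\dots+\pi_{iJ})$ (continuation-ratio). It is assumed that $\pi_{ij}>0$ for all $i,j$. Matrix form: $\mathbf C^T\log(\mathbf L\boldsymbol\pi_i)=\mathbf X_i\boldsymbol\theta$ with entrywise $\log$, where $\mathbf C^T=\begin{pmatrix}\mathbf I_{J-1}&-\mathbf I_{J-1}&\mathbf 0\\ \mathbf 0^T&\mathbf 0^T&1\end{pmatrix}$ is $J\times(2J-1)$; $\mathbf L$ is the $(2J-1)\times J$ 0-1 matrix with $(\mathbf L\boldsymbol\pi_i)_j=\nu_{ij}$, $(\mathbf L\boldsymbol\pi_i)_{J-1+j}=\delta_{ij}$ ($j=1,\dots,J-1$), and last row all ones; and $\mathbf X_i$ is the $J\times p$ matrix whose $j$th row ($j\le J-1$)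 has $\mathbf h_j^T(\mathbf x_i)$ in the block of columns of $\boldsymbol\beta_j$, $\mathbf h_c^T(\mathbf x_i)$ in the block of columns of $\boldsymbol\zeta$, and zeros elsewhere, and whose last row is zero. The matrix $\mathbf C^T\mathbf D_i^{-1}\mathbf L$, with $\mathbf D_i={\rm diag}(\mathbf L\boldsymbol\pi_i)$, is $J\times J$ and nonsingular. The Fisher information matrix is the covariance matrix of the score vector $\partial l/\partial\boldsymbol\theta$, where $l$ is the log-likelihood of $(\mathbf Y_i)_i$. $\partial\boldsymbol\pi_i/\partial\boldsymbol\theta^T$ denotes the $J\times p$ Jacobian matrix. *)

(* Defs.v *)
From HB Require Import structures.
From mathcomp Require Import all_boot all_order all_algebra.
From mathcomp Require Import all_classical all_reals all_analysis.

Set Implicit Arguments.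
Unset Strict Implicit.
Unset Printing Implicit Defensive.

Import Order.TTheory GRing.Theory Num.Theory.
Import numFieldNormedType.Exports.

Local Open Scope classical_set_scope.
Local Open Scope ring_scope.

(* There are K = J - 1 logits, hence J = K + 1 response categories.  Indices
   start at 0: logit j : 'I_K and category k : 'I_(K + 1) stand for j + 1 and
   k + 1 in one-based numbering, and category K is the last (baseline) one. *)

Inductive logit_type := Baseline | Cumulative | Adjacent | Continuation.

(* Category k is one of the summands of nu_j. *)
Definition in_num (lt : logit_type) (j k : nat) : bool :=
  match lt with
  | Baseline => k == j
  | Cumulative => (k <= j)%N
  | Adjacent => k == j
  | Continuation => k == j
  end.

(* Category k is one of the summands of delta_j. *)
Definition in_den (lt : logit_type) (K j k : nat) : bool :=
  match lt with
  | Baseline => k == K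
  | Cumulative => (j < k)%N
  | Adjacent => k == j.+1
  | Continuation => (j < k)%N
  end.

Definition CT (R : realType) (K : nat) : 'M[R]_(K + 1, K + K + 1) :=
  block_mx (row_mx 1%:M (- 1%:M)) 0 0 1%:M.

Definition Lmx (R : realType) (K : nat) (lt : logit_type) :
    'M[R]_(K + K + 1, K + 1) :=
  col_mx (col_mx (\matrix_(j, k) (in_num lt j k)%:R)
                 (\matrix_(j, k) (in_den lt K j k)%:R))
         (const_mx 1).

Definition Dmx (R : realType) (K : nat) (lt : logit_type)
    (q : 'cV[R]_(K + 1)) : 'M[R]_(K + K + 1) :=
  diag_mx (Lmx R K lt *m q)^T.

Definition CDL (R : realType) (K : nat) (lt : logit_type)
    (q : 'cV[R]_(K + 1)) : 'M[R]_(K + 1) :=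
  CT R K *m invmx (Dmx lt q) *m Lmx R K lt.

(* The parameter is the stacked vector (beta_1, ..., beta_K, zeta), of size
   \sum_j p j + pc; [h] gives the category-specific predictors and [hc] the
   common ones. *)
Definition Xmx (R : realType) (d K : nat) (p : 'I_K -> nat) (pc : nat)
    (h : forall j : 'I_K, 'rV[R]_d -> 'cV[R]_(p j))
    (hc : 'rV[R]_d -> 'cV[R]_pc) (x : 'rV[R]_d) :
    'M[R]_(K + 1, \sum_j p j + pc) :=
  col_mx (\matrix_(j < K)
            row_mx (mxrow (fun k : 'I_K => if k == j then (h k x)^T else 0))
                   (hc x)^T)
         0.

(* [q] is the vector of category probabilities that the model assigns to the
   setting with model matrix [X] when the parameter is [theta]. *)
Definition model_prob (R : realType) (K : nat) (lt : logit_type) (r : nat)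
    (X : 'M[R]_(K + 1, r)) (theta : 'cV[R]_r) (q : 'cV[R]_(K + 1)) : Prop :=
  [/\ forall j, 0 < q j 0,
      \sum_j q j 0 = 1
    & CT R K *m map_mx (@ln R) (Lmx R K lt *m q) = X *m theta].

(* For cumulative logits this may be a proper subset of the whole space, since
   the values of the logits have to be strictly increasing in j. *)
Definition param_space (R : realType) (K : nat) (lt : logit_type) (r m : nat)
    (X : 'I_m -> 'M[R]_(K + 1, r)) : set 'cV[R]_r :=
  [set theta | forall i, exists q, model_prob lt (X i) theta q].

Definition multinomial_pmf (R : realType) (J : nat) (N : nat) (q : 'cV[R]_J)
    (y : 'I_J -> nat) : R :=
  if (\sum_j y j == N)%N
  then (N`!)%:R / (\prod_j ((y j)`!)%:R) * \prod_j q j 0 ^+ y j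
  else 0.

Definition multinomial_law (d : measure_display) (T : measurableType d)
    (R : realType) (P : probability T R) (J N : nat) (q : 'cV[R]_J)
    (Y : 'I_J -> T -> nat) : Prop :=
  forall y : 'I_J -> nat,
    P [set w | forall j, Y j w = y j] = (multinomial_pmf N q y)%:E.

(* Mutual independence of the count vectors Y_i, i \in D.  Vectors of J counts
   form a countable space, so the events range over all sets of such vectors. *)
Definition indep_counts (d : measure_display) (T : measurableType d)
    (R : realType) (P : probability T R) (m J : nat) (D : {set 'I_m})
    (Y : 'I_m -> 'I_J -> T -> nat) : Prop :=
  forall S : {set 'I_m}, S \subset D ->
  forall A : 'I_m -> set ('I_J -> nat),
    P [set w | forall i, i \in S -> A i (fun j => Y i j w)] =
    (\prod_(i in S) P [set w | A i (fun j => Y i j w)])%E.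

(* Log of the joint probability mass function of the observed vectors, that is
   those with n i > 0.  Outside the support ln 0 = 0, on a null event. *)
Definition loglik (R : realType) (J r m : nat) (n : 'I_m -> nat)
    (prob : 'I_m -> 'cV[R]_r -> 'cV[R]_J) (y : 'I_m -> 'I_J -> nat)
    (theta : 'cV[R]_r) : R :=
  ln (\prod_(i | (0 < n i)%N) multinomial_pmf (n i) (prob i theta) (y i)).

Definition gradient (R : realType) (r : nat) (f : 'cV[R]_r -> R)
    (theta : 'cV[R]_r) : 'cV[R]_r :=
  \col_k 'D_(delta_mx k 0) f theta.

(* Jacobian of a map between column vectors; the library's ['J] acts on row
   vectors and is the transpose of this one. *)
Definition jacobian_mx (R : realType) (r s : nat) (f : 'cV[R]_r -> 'cV[R]_s)
    (theta : 'cV[R]_r) : 'M[R]_(s, r) :=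
  \matrix_(j, k) 'D_(delta_mx k 0) (fun t => f t j 0) theta.

Definition covariance_mx (d : measure_display) (T : measurableType d)
    (R : realType) (P : probability T R) (r : nat) (V : T -> 'cV[R]_r) :
    'M[\bar R]_r :=
  \matrix_(k, l) covariance P (fun w => V w k 0) (fun w => V w l 0).

Definition score (d : measure_display) (T : measurableType d) (R : realType)
    (J r m : nat) (n : 'I_m -> nat) (prob : 'I_m -> 'cV[R]_r -> 'cV[R]_J)
    (Y : 'I_m -> 'I_J -> T -> nat) (theta : 'cV[R]_r) (w : T) : 'cV[R]_r :=
  gradient (loglik n prob (fun i j => Y i j w)) theta.

Definition fisher_information (d : measure_display) (T : measurableType d)
    (R : realType) (P : probability T R) (J r m : nat) (n : 'I_m -> nat)
    (prob : 'I_m -> 'cV[R]_r -> 'cV[R]_J) (Y : 'I_m -> 'I_J -> T -> nat)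
    (theta : 'cV[R]_r) : 'M[\bar R]_r :=
  covariance_mx P (score n prob Y theta).

Definition Fi (R : realType) (J r : nat) (f : 'cV[R]_r -> 'cV[R]_J)
    (theta : 'cV[R]_r) : 'M[R]_r :=
  (jacobian_mx f theta)^T *m invmx (diag_mx (f theta)^T)
    *m jacobian_mx f theta.

(* Main.v *)
Require Import Defs.
From HB Require Import structures.
From mathcomp Require Import all_boot all_order all_algebra.
From mathcomp Require Import all_classical all_reals all_analysis.
From mathcomp Require Import ring.

(* - Solving the model: a vector u with total 0 whose numerator and denominator
     sums are proportional to those of q is 0. Applied to the kernel of
     C^T D^-1 L this gives invertibility; applied to the difference of two
     solutions it gives uniqueness. Differentiable solutions near theta are
     explicit: cumulative probabilities are logistic functions of the linear
     predictors, and for the other types the odds w_k = pi_k / pi_K satisfy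
     w_j = exp(eta_j) * (sum of w_k over the denominator of logit j), a downward
     recursion. Differentiating the model equation gives the Jacobian.
   - The score is the sum over i and j of Y_ij (d pi_ij / d theta) / pi_ij, a
     statistic linear in the counts with weights centred under pi_i. Splitting
     off one trial at a time, the covariance of two such statistics is n_i times
     the covariance for a single trial.
   - Unless the counts have totals n_i, the log-likelihood is constantly
     ln 0 = 0 and the score vanishes; so the score is exactly a finite
     combination of indicators of count tables, whose probabilities are products
     of multinomial ones. *)

Import Order.TTheory GRing.Theory Num.Theory.
Import numFieldNormedType.Exports.

Set Implicit Arguments.
Unset Strict Implicit.
Unset Printing Implicit Defensive.

Local Open Scope classical_set_scope.
Local Open Scope ring_scope.

(** * Linear algebra of the logit map *)

Lemma invmx_diag (F : fieldType) (n : nat) (v : 'rV[F]_n) :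
  (forall i, v 0 i != 0) -> invmx (diag_mx v) = diag_mx (\row_i (v 0 i)^-1).
Proof.
move=> v0; have vV : diag_mx v *m diag_mx (\row_i (v 0 i)^-1) = 1%:M.
  rewrite mulmx_diag -diag_const_mx; congr diag_mx.
  by apply/rowP => i; rewrite !mxE mulfV.
have [uv _] := mulmx1_unit vV.
by rewrite -[LHS]mulmx1 -vV mulKmx.
Qed.

Lemma sum_mem_mxE (R : pzSemiRingType) (J r : nat) (S : pred 'I_J)
    (A : 'M[R]_(J, r)) k :
  \sum_l (S l)%:R * A l k = \sum_(l | S l) A l k.
Proof.
by rewrite [RHS]big_mkcond; apply: eq_bigr => l _; case: (S l); rewrite ?mul1r ?mul0r.
Qed.

Lemma Lmx_mul (R : realType) (K : nat) (lt : logit_type) (r : nat)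
    (A : 'M[R]_(K + 1, r)) :
  Lmx R K lt *m A =
  col_mx (col_mx (\matrix_(j < K, k < r) \sum_(l < K + 1 | in_num lt j l) A l k)
                 (\matrix_(j < K, k < r) \sum_(l < K + 1 | in_den lt K j l) A l k))
         (\matrix_(j < 1, k < r) \sum_l A l k).
Proof.
rewrite /Lmx !mul_col_mx; congr (col_mx (col_mx _ _) _); apply/matrixP => j k;
  rewrite !mxE.
- by rewrite -sum_mem_mxE; apply: eq_bigr => l _; rewrite mxE.
- by rewrite -sum_mem_mxE; apply: eq_bigr => l _; rewrite mxE.
- by apply: eq_bigr => l _; rewrite mxE mul1r.
Qed.

Lemma CT_mul (R : realType) (K r : nat) (A B : 'M[R]_(K, r)) (C : 'M[R]_(1, r)) :
  CT R K *m col_mx (col_mx A B) C = col_mx (A - B) C.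
Proof.
rewrite /CT mul_block_col !mul0mx mul1mx addr0 add0r mul_row_col.
by rewrite mul1mx mulNmx mul1mx.
Qed.

Lemma in_num_exists (lt : logit_type) (K : nat) (j : 'I_K) :
  exists k : 'I_(K + 1), in_num lt j k.
Proof. by exists (lshift 1 j); case: lt => /=. Qed.

Lemma in_den_exists (lt : logit_type) (K : nat) (j : 'I_K) :
  exists k : 'I_(K + 1), in_den lt K j k.
Proof.
have jK : (j.+1 < K + 1)%N by rewrite addn1 ltnS.
have KK : (K < K + 1)%N by rewrite addn1.
by case: lt; [exists (Ordinal KK)|exists (Ordinal jK)..] => /=.
Qed.

Section Logits.
Context {R : realType} {K : nat} (lt : logit_type).
Implicit Types (q u : 'cV[R]_(K + 1)) (j : 'I_K).

Definition logit_num q j : R := \sum_(l | in_num lt j (l : 'I_(K + 1))) q l 0.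
Definition logit_den q j : R := \sum_(l | in_den lt K j (l : 'I_(K + 1))) q l 0.

Lemma sum_pos (S : pred 'I_(K + 1)) q : (forall l, 0 < q l 0) ->
  (exists k, S k) -> 0 < \sum_(l | S l) q l 0.
Proof.
move=> q0 [k Sk]; rewrite (bigD1 k) //= ltr_pwDl ?sumr_ge0 // => l _.
exact: ltW.
Qed.

Lemma logit_num_gt0 q j : (forall l, 0 < q l 0) -> 0 < logit_num q j.
Proof. by move=> q0; apply: sum_pos => //; apply: in_num_exists. Qed.

Lemma logit_den_gt0 q j : (forall l, 0 < q l 0) -> 0 < logit_den q j.
Proof. by move=> q0; apply: sum_pos => //; apply: in_den_exists. Qed.

Lemma total_gt0 q : (forall l, 0 < q l 0) -> 0 < \sum_l q l 0.
Proof. by move=> q0; apply: sum_pos => //; exists (rshift K 0). Qed.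

(** C^T D^-1 L is the differential of q -> C^T log(L q), so columns of [A] are sent to differences
    of logarithmic derivatives. *)
Lemma CDL_mul q (r : nat) (A : 'M[R]_(K + 1, r)) : (forall l, 0 < q l 0) ->
  CDL lt q *m A =
  col_mx (\matrix_(j < _, k < r) (logit_num (col k A) j / logit_num q j -
                            logit_den (col k A) j / logit_den q j))
         (\matrix_(j < _, k < r) ((\sum_l A l k) / (\sum_l q l 0))).
Proof.
move=> q0; have D0 i : (Lmx R K lt *m q)^T 0 i != 0.
  rewrite Lmx_mul mxE.
  case: (split_ordP i) => [i'|i'] ->; last first.
    by rewrite col_mxEd mxE gt_eqF ?total_gt0.
  rewrite col_mxEu; case: (split_ordP i') => [j|j] ->.
    by rewrite col_mxEu mxE gt_eqF ?logit_num_gt0.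
  by rewrite col_mxEd mxE gt_eqF ?logit_den_gt0.
rewrite /CDL -!mulmxA /Dmx invmx_diag // mul_diag_mx.
set B := \matrix_(i, j) _.
have -> : B = col_mx
    (col_mx (\matrix_(j < _, k < r) (logit_num (col k A) j / logit_num q j))
            (\matrix_(j < _, k < r) (logit_den (col k A) j / logit_den q j)))
               (\matrix_(j < _, k < r) ((\sum_l A l k) / (\sum_l q l 0))).
  apply/matrixP => i k; rewrite /B [LHS]mxE [X in X * _]mxE [X in X^-1]mxE mulrC !Lmx_mul.
  case: (split_ordP i) => [i'|i'] ->; rewrite ?col_mxEu ?col_mxEd.
    case: (split_ordP i') => [j|j] ->; rewrite ?col_mxEu ?col_mxEd !mxE;
      by congr (_ / _); apply: eq_bigr => l _; rewrite mxE.
  by rewrite !mxE.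
rewrite CT_mul; congr col_mx; apply/matrixP => j k; by rewrite !mxE.
Qed.

End Logits.

(** Makes downward induction on the categories possible, both for uniqueness and for the
    construction of solutions. *)
Lemma in_den_gt (lt : logit_type) (K j k : nat) :
  (j < K)%N -> in_den lt K j k -> (j < k)%N.
Proof. by case: lt => //= jK /eqP ->. Qed.

(** Outside the cumulative case a numerator is a single category, so each logit equation determines
    it from later categories. *)
Lemma logit_type_cumulativeP (lt : logit_type) :
  lt = Defs.Cumulative \/ (forall j k, in_num lt j k = (k == j)).
Proof. by case: lt; [right|left|right|right]. Qed.

(** * Injectivity of the logit map and uniqueness of solutions *)

Section LogitKernel.
Context {R : realType} {K : nat} (lt : logit_type).
Implicit Types (q u : 'cV[R]_(K + 1)) (j : 'I_K).

Lemma logit_num_single u j : (forall j k, in_num lt j k = (k == j)) ->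
  logit_num lt u j = u (lshift 1 j) 0.
Proof.
move=> numE; by rewrite /logit_num (big_pred1 (lshift 1 j)) // => l; rewrite numE.

Qed.

Lemma logit_num_den_cumulative u j :
  logit_num Defs.Cumulative u j + logit_den Defs.Cumulative u j = \sum_l u l 0.
Proof.
rewrite /logit_num /logit_den.
rewrite [RHS](bigID (fun l : 'I_(K + 1) => in_num Defs.Cumulative j l)) /=.
by congr (_ + _); apply: eq_bigl => l; rewrite ltnNge.
Qed.

(** Cumulative logits: all partial sums of [u] vanish. Other types: going down from the last
    category, [u] is a multiple of [q], and the zero total forces the factor to be 0. *)
Lemma logit_kernel q u : (forall l, 0 < q l 0) ->
  (forall j,
    logit_num lt u j / logit_num lt q j = logit_den lt u j / logit_den lt q j) ->
  \sum_l u l 0 = 0 -> u = 0.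
Proof.
move=> q0 uq u0; have [ltE|numE] := logit_type_cumulativeP lt.
  subst lt; have cum0 (l : 'I_(K + 1)) :
      \sum_(k < K + 1 | (k <= l)%N) u k 0 = 0.
    case: (split_ordP l) => j -> /=; last first.
      rewrite -[RHS]u0; apply: eq_bigl => k.
      by rewrite ord1 addn0 -ltnS -[X in (_ < X)%N]addn1 ltn_ord.
    (* The denominator sum of [u] is -S, S being its numerator sum, so the hypothesis reads S (1/num
       q + 1/den q) = 0 with a positive second factor. *)
    have := uq j; rewrite -[LHS]/(logit_num Defs.Cumulative u j / _).
    have /eqP := logit_num_den_cumulative u j; rewrite u0 addrC addr_eq0 => /eqP ->.
    have V0 : 0 < (logit_num Defs.Cumulative q j)^-1
        + (logit_den Defs.Cumulative q j)^-1.
      by rewrite addr_gt0 // invr_gt0 ?logit_num_gt0 ?logit_den_gt0.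
    move/eqP; rewrite mulNr -subr_eq0 opprK -mulrDr mulf_eq0 (gt_eqF V0) orbF.
    by move/eqP.
  apply/colP => l; rewrite mxE.
  have [n] := ubnP (val l); elim: n l => // n IH l ln.
  have := cum0 l; rewrite (bigD1 l) //= big1 ?addr0 // => k /andP[kl kNl].
  have kl' : (k < l)%N by rewrite ltn_neqAle kl andbT.
  by rewrite IH ?mxE // (leq_trans kl').
pose c := u (rshift K 0) 0 / q (rshift K 0) 0.
have ucq (l : 'I_(K + 1)) : u l 0 = c * q l 0.
  have [n] := ubnP (K - l); elim: n l => // n IH l ln.
  case: (split_ordP l) ln => j -> /= ln; last first.
    by rewrite ord1 /c divfK // gt_eqF.
  have := uq j; rewrite !logit_num_single //.
  have -> : logit_den lt u j = c * logit_den lt q j.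
    rewrite /logit_den mulr_sumr; apply: eq_bigr => k /(in_den_gt (ltn_ord j)) jk.
    apply: IH; rewrite -ltnS (leq_trans _ ln) // ltnS ltn_sub2l //.
  rewrite mulfK ?gt_eqF ?logit_den_gt0 // => /(canRL (divfK _)) -> //.
  by rewrite gt_eqF.
move: u0; under eq_bigr do rewrite ucq.
rewrite -mulr_sumr => /eqP; rewrite mulf_eq0 [X in _ || X]gt_eqF ?total_gt0 //.
by rewrite orbF => /eqP c0; apply/colP => l; rewrite ucq c0 mul0r mxE.
Qed.

(** For a square matrix a trivial kernel suffices; the transpose appears because [kermx] is the left
    kernel. *)
Lemma CDL_unitmx q : (forall l, 0 < q l 0) -> CDL lt q \in unitmx.
Proof.
move=> q0; rewrite -unitmx_tr -row_free_unit -kermx_eq0; apply/eqP/row_matrixP.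
move=> i; rewrite row0; apply: trmx_inj; rewrite trmx0.
have : CDL lt q *m (row i (kermx (CDL lt q)^T))^T = 0.
  apply: trmx_inj; rewrite trmx_mul trmxK trmx0 -row_mul mulmx_ker.
  by rewrite row0.
set u := (row i _)^T; rewrite CDL_mul // -[0 in RHS]col_mx0 => /eq_col_mx[logit0 sum0].
apply: (logit_kernel q0) => [j|].
  have /matrixP/(_ j 0) := logit0; rewrite !mxE !col_id => /eqP.
  by rewrite subr_eq0 => /eqP.
have /matrixP/(_ 0 0) := sum0; rewrite !mxE => /eqP.
by rewrite mulf_eq0 invr_eq0 [X in _ || X]gt_eqF ?total_gt0 // orbF => /eqP.
Qed.

(** With a zero last row in [X], the last component of the model equation says that ln of the total
    is 0, which total 1 already implies. *)
Lemma model_probE (r : nat) (X : 'M[R]_(K + 1, r)) t q : dsubmx X = 0 ->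
  model_prob lt X t q <->
  [/\ forall l, 0 < q l 0, \sum_l q l 0 = 1 &
      forall j, ln (logit_num lt q j) - ln (logit_den lt q j) =
        (X *m t) (lshift 1 j) 0].
Proof.
move=> X0; have XtE : X *m t = col_mx (usubmx X *m t) 0.
  by rewrite -[X in LHS]vsubmxK mul_col_mx X0 mul0mx.
rewrite /model_prob Lmx_mul !map_col_mx CT_mul XtE.
split=> -[q0 q1 logitE]; split=> //.
  move=> j; have [/matrixP/(_ j 0) e _] := eq_col_mx logitE.
  by rewrite col_mxEu -e !mxE.
congr col_mx; apply/matrixP => j k; rewrite !ord1.
  by have := logitE j; rewrite col_mxEu => <-; rewrite !mxE.
by rewrite !mxE q1 ln1.
Qed.

(** Equal logits mean equal ratios num/den, hence num q'/num q = den q'/den q; subtracting 1 gives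
    the hypothesis of [logit_kernel] for q' - q. *)
Lemma model_prob_inj (r : nat) (X : 'M[R]_(K + 1, r)) t q q' :
  dsubmx X = 0 -> model_prob lt X t q -> model_prob lt X t q' -> q = q'.
Proof.
move=> X0 /(model_probE _ _ X0)[q0 q1 qE] /(model_probE _ _ X0)[q'0 q'1 q'E].
apply/eqP; rewrite eq_sym -subr_eq0; apply/eqP.
have sumB (S : pred 'I_(K + 1)) : \sum_(l | S l) (q' - q) l 0 =
    \sum_(l | S l) q' l 0 - \sum_(l | S l) q l 0.
  by rewrite -sumrB; apply: eq_bigr => l _; rewrite !mxE.
apply: (logit_kernel q0) => [j|]; last by rewrite sumB q1 q'1 subrr.
rewrite /logit_num /logit_den !sumB -!/(logit_num _ _ _) -!/(logit_den _ _ _).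
have [nq nq' dq dq'] : [/\ 0 < logit_num lt q j, 0 < logit_num lt q' j,
    0 < logit_den lt q j & 0 < logit_den lt q' j].
  by split; rewrite ?logit_num_gt0 ?logit_den_gt0.
rewrite !mulrBl !mulfV ?gt_eqF //; congr (_ - 1).
have : ln (logit_num lt q' j / logit_den lt q' j) =
    ln (logit_num lt q j / logit_den lt q j).
  by rewrite !ln_div ?posrE // qE q'E.
move/ln_inj; rewrite !posrE !divr_gt0 // => /(_ isT isT) /eqP.
rewrite eqr_div ?lt0r_neq0 // => /eqP e; apply/eqP.
by rewrite eqr_div ?lt0r_neq0 // e mulrC.
Qed.

End LogitKernel.

(** * Differentiability *)

Section DifferentialFacts.
Context {R : realType} {V : normedModType R}.

Lemma near_eq_differentiable {W : normedModType R} (f g : V -> W) (x : V) :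
  (\forall y \near x, f y = g y) -> differentiable f x -> differentiable g x.
Proof.
move=> fg df; have fgx : f x = g x := nbhs_singleton fg.
have gE : g \o shift x = cst (g x) + 'd f x +o_ 0 id.
  apply/eqaddoP => e e0; have /eqaddoP/(_ e e0) fE := diff_locally df.
  have fg0 : \forall h \near 0, f (h + x) = g (h + x).
    by move: fg; rewrite (near_shift 0) /=; apply: filterS => h; rewrite subr0.
  near=> h.
  have : `|(f \o shift x - (cst (f x) + 'd f x)) h| <= e * `|h| by near: h.
  by rewrite !fctE /= fgx (near fg0 h).
have dfc := diff_continuous df.
by apply/diff_locallyP; rewrite (diff_unique dfc gE).
Unshelve. all: by end_near. Qed.

Lemma differentiable_bigsum {W : normedModType R} (I : Type) (s : seq I)
    (P : pred I) (f : I -> V -> W) (x : V) :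
  (forall i, P i -> differentiable (f i) x) ->
  differentiable (fun t => \sum_(i <- s | P i) f i t) x.
Proof.
move=> df; rewrite (_ : (fun t => _) = \sum_(i <- s | P i) f i); last first.
  by apply/funext => t; rewrite fct_sumE.
apply: (big_ind (fun g : V -> W => differentiable g x)).
- exact: differentiable_cst.
- by move=> g h; apply: differentiableD.
- exact: df.
Qed.

Lemma derive_bigsum {W : normedModType R} (I : Type) (s : seq I)
    (P : pred I) (f : I -> V -> W) (x v : V) :
  (forall i, P i -> differentiable (f i) x) ->
  'D_v (fun t => \sum_(i <- s | P i) f i t) x = \sum_(i <- s | P i) 'D_v (f i) x.
Proof.
move=> df; elim: s => [|i s IH].
  rewrite big_nil (_ : (fun t => _) = cst 0) ?derive_cst //.
  by apply/funext => t; rewrite big_nil.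
rewrite big_cons; case: ifPn => Pi; last first.
  rewrite -IH; congr ('D_v _ x); apply/funext => t.
  by rewrite big_cons (negbTE Pi).
rewrite -IH -deriveD.
- by congr ('D_v _ x); apply/funext => t; rewrite big_cons Pi.
- by apply: diff_derivable; apply: df.
- by apply: diff_derivable; apply: differentiable_bigsum.
Qed.

Lemma differentiable_mx (m n : nat) (f : V -> 'M[R]_(m, n)) (x : V) :
  (forall i j, differentiable (fun t => f t i j) x) -> differentiable f x.
Proof.
move=> df.
rewrite (_ : f = fun t => \sum_i \sum_j f t i j *: delta_mx i j); last first.
  by apply/funext => t; apply: matrix_sum_delta.
apply: differentiable_bigsum => i _; apply: differentiable_bigsum => j _.
exact: differentiableZl.
Qed.

Lemma differentiable_expR (f : V -> R) (x : V) :
  differentiable f x -> differentiable (fun t => expR (f t)) x.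
Proof.
move=> df; apply: (differentiable_comp df).
exact/derivable1_diffP/derivable_expR.
Qed.

Lemma differentiable_ln (f : V -> R) (x : V) :
  0 < f x -> differentiable f x -> differentiable (fun t => ln (f t)) x.
Proof.
move=> fx0 df; apply: (differentiable_comp df).
by apply/derivable1_diffP; have [] := is_derive1_ln fx0.
Qed.

Lemma derive_ln (f : V -> R) (x v : V) : 0 < f x -> differentiable f x ->
  'D_v (fun t => ln (f t)) x = 'D_v f x / f x.
Proof.
move=> fx0 df; have [dln lnE] := is_derive1_ln fx0.
have dln' : differentiable (@ln R) (f x) by apply/derivable1_diffP.
rewrite deriveE; last exact: differentiable_ln.
rewrite (diff_comp df dln') /= deriv1E // derive1E lnE deriveE //.
Qed.

End DifferentialFacts.

Lemma differentiable_mulmx_coord {R : realType} (m n : nat) (A : 'M[R]_(m, n)) i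
    (x : 'cV[R]_n) :
  differentiable (fun t : 'cV[R]_n => (A *m t) i 0) x.
Proof.
rewrite (_ : (fun t => _) = fun t : 'cV[R]_n => \sum_k A i k *: t k 0); last first.
  by apply/funext => t; rewrite mxE.
apply: differentiable_bigsum => k _.
by apply: differentiableZ; apply: differentiable_coord.
Qed.

Lemma derive_mulmx_coord {R : realType} (m n : nat) (A : 'M[R]_(m, n)) i k
    (x : 'cV[R]_n) :
  'D_(delta_mx k 0) (fun t : 'cV[R]_n => (A *m t) i 0) x = A i k.
Proof.
(* The difference quotient of a linear map is constant away from 0. *)
rewrite /derive (_ : (fun h => _) = fun h : R => (h^-1 * h) * A i k).
  apply: cvg_lim => //; apply: cvg_near_cst.
  near=> h; rewrite mulVf ?mul1r //.
  by near: h; exact: nbhs_dnbhs_neq.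
apply/funext => h /=; rewrite mulmxDr mxE addrK -scalemxAr mxE.
by rewrite -colE mxE -mulrA.
Unshelve. all: by end_near. Qed.

(** * Differentiable solutions near a given parameter *)

Section LocalSolution.
Context {R : realType} {K : nat} (lt : logit_type) (r : nat).
Implicit Types (q u : 'cV[R]_(K + 1)) (j : 'I_K).

(* The [w k] are the odds pi_k / pi_K only when the numerator of logit j is
   category j, that is for all logits but the cumulative ones. *)
Lemma baseline_odds_exist (V : normedModType R) (x : V) (eta : 'I_K -> V -> R) :
  (forall j, differentiable (eta j) x) ->
  exists w : nat -> V -> R,
    [/\ forall k, differentiable (w k) x, forall k t, 0 < w k t &
     forall j t, w j t = expR (eta j t) * \sum_(k < K + 1 | in_den lt K j k) w k t].
Proof.
move=> deta.
(* The recursion starts at the last logit: after [n] rounds the logits j >= K - n are settled. *)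
suff exists_upto n : exists w : nat -> V -> R,
    [/\ forall k, differentiable (w k) x, forall k t, 0 < w k t &
     forall j t, (K - n <= j)%N ->
       w j t = expR (eta j t) * \sum_(k < K + 1 | in_den lt K j k) w k t].
  have [w [dw w0 wE]] := exists_upto K.
  by exists w; split=> // j t; apply: wE; rewrite subnn.
elim: n => [|n [w [dw w0 wE]]].
  (* No logit is settled yet. The value 1 at index K survives, since later rounds change only
     indices below K. *)
  exists (fun _ => cst 1); split=> //= j t; rewrite subn0 leqNgt ltn_ord //.
have [nK|Kn] := ltnP n K; last first.
  exists w; split=> // j t _; apply: wE.
  by rewrite (eqP (_ : (K - n == 0)%N)) // subn_eq0.
have j0K : (K - n.+1 < K)%N by rewrite ltn_subrL (leq_ltn_trans _ nK).
pose j0 := Ordinal j0K.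
pose w0' t := expR (eta j0 t) * \sum_(k < K + 1 | in_den lt K j0 k) w k t.
exists (fun k : nat => if k == j0 :> nat then w0' else w k); split.
- move=> k; case: eqP => // _; apply: differentiableM.
    exact: differentiable_expR.
  by apply: differentiable_bigsum => l _; apply: dw.
- move=> k t; case: eqP => // _; rewrite mulr_gt0 ?expR_gt0 //.
  have [l lden] := in_den_exists lt j0.
  rewrite (bigD1 l) //= ltr_pwDl // sumr_ge0 // => i _; exact: ltW.
(* Changing the value at [j0] leaves the denominators of the logits j >= j0 untouched: their
   categories come strictly after j. *)
move=> j t jn; have denE : \sum_(k < K + 1 | in_den lt K j k)
      (if k == j0 :> nat then w0' else w k) t
    = \sum_(k < K + 1 | in_den lt K j k) w k t.
  apply: eq_bigr => k /(in_den_gt (ltn_ord j)) jk.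
  by rewrite gtn_eqF // (leq_ltn_trans jn jk).
rewrite denE; case: eqP => [/val_inj -> //|/eqP jNj0]; apply: wE.
have := jn; rewrite leq_eqVlt eq_sym (negbTE jNj0) /=; apply: leq_trans.
by rewrite -subSS subSn.
Qed.

(** Outside the cumulative case the normalised odds solve the model at every parameter. For
    cumulative logits the explicit formula may fail to be positive, but it gives [q] at [theta] and
    so stays positive nearby. *)
Lemma local_solution (X : 'M[R]_(K + 1, r)) (theta : 'cV[R]_r) q :
  dsubmx X = 0 -> model_prob lt X theta q ->
  exists f : 'cV[R]_r -> 'cV[R]_(K + 1),
    differentiable f theta /\ \forall t \near theta, model_prob lt X t (f t).
Proof.
move=> X0 /(model_probE _ _ _ X0)[q0 q1 qE].
pose eta j (t : 'cV[R]_r) : R := (X *m t) (lshift 1 j) 0.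
have deta j : differentiable (eta j) theta by apply: differentiable_mulmx_coord.
have [ltE|numE] := logit_type_cumulativeP lt; last first.
  have [w [dw w0 wE]] := baseline_odds_exist deta.
  pose s t := \sum_(k < K + 1) w k t.
  have s0 t : 0 < s t.
    rewrite /s (bigD1 (rshift K 0)) //= ltr_pwDl // sumr_ge0 // => i _.
    exact: ltW.
  have ds : differentiable s theta by apply: differentiable_bigsum.
  exists (fun t => \col_k (w k t / s t)); split.
    apply: differentiable_mx => k l.
    rewrite (_ : (fun t => _) = w k * (fun t => (s t)^-1)); last first.
      by apply/funext => t; rewrite mxE.
    apply: differentiableM; first exact: dw.
    by apply: differentiableV => //; rewrite gt_eqF.
  apply: filterE => t; apply/(model_probE _ _ _ X0); split.
  - by move=> l; rewrite mxE divr_gt0.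
  - under eq_bigr do rewrite mxE.
    by rewrite -mulr_suml mulfV // lt0r_neq0 // s0.
  move=> j; rewrite logit_num_single // mxE.
  have -> : logit_den lt (\col_k (w k t / s t)) j =
      (\sum_(k < K + 1 | in_den lt K j k) w k t) / s t.
    by rewrite mulr_suml; apply: eq_bigr => k _; rewrite mxE.
  have den0 : 0 < \sum_(k < K + 1 | in_den lt K j k) w k t.
    have [l lden] := in_den_exists lt j.
    by rewrite (bigD1 l) //= ltr_pwDl // sumr_ge0 // => i _; exact: ltW.
  rewrite -ln_div ?posrE ?divr_gt0 // wE.
  by rewrite invf_div mulrA divfK ?lt0r_neq0 // mulfK ?lt0r_neq0 // expRK.
subst lt.
(* The probability of the first n categories: 0 for n = 0, logistic for 1 <= n <= K, and 1 for n >
   K, where [insub] fails. *)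
pose cum (n : nat) (t : 'cV[R]_r) : R :=
  if n is n'.+1 then
    if (insub n' : option 'I_K) is Some j
    then expR (eta j t) / (1 + expR (eta j t)) else 1
  else 0.
have expD0 y : 1 + expR y != 0 :> R by rewrite gt_eqF // addr_gt0 ?expR_gt0.
have dcum n : differentiable (cum n) theta.
  case: n => [|n]; first exact: differentiable_cst.
  rewrite /cum; case: insub => [j|]; last exact: differentiable_cst.
  apply: differentiableM; first exact: differentiable_expR.
  apply: differentiableV => //; apply: differentiableD => //.
  exact: differentiable_expR.
have cumE j t : cum j.+1 t = expR (eta j t) / (1 + expR (eta j t)).
  by rewrite /cum valK.
have cumK t : cum K.+1 t = 1 by rewrite /cum insubF // ltnn.
pose f t : 'cV[R]_(K + 1) := \col_k (cum k.+1 t - cum k t).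
have sum_f n t : (n <= K)%N -> \sum_(k < K + 1 | (k <= n)%N) f t k 0 = cum n.+1 t.
  move=> nK; have nK1 : (n.+1 <= K + 1)%N by rewrite addn1.
  transitivity (\sum_(k < K + 1 | (k < n.+1)%N) (cum k.+1 t - cum k t)).
    by apply: eq_bigr => k _; rewrite mxE.
  rewrite -(big_ord_widen (K + 1) (fun k => cum k.+1 t - cum k t) nK1).
  by rewrite -(big_mkord xpredT (fun k => cum k.+1 t - cum k t)) telescope_sumr // subr0.
have df : differentiable f theta.
  apply: differentiable_mx => k l.
  rewrite (_ : (fun t => _) = cum k.+1 - cum k); last first.
    by apply/funext => t; rewrite mxE.
  exact: differentiableB.
have f1 t : \sum_l f t l 0 = 1.
  rewrite -(cumK t) -sum_f //; apply: eq_bigl => k.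
  by rewrite -ltnS -[X in (_ < X)%N]addn1 ltn_ord.
have numE t j : logit_num Defs.Cumulative (f t) j = cum j.+1 t.
  by apply: sum_f; exact: ltnW.
have denE t j : logit_den Defs.Cumulative (f t) j = 1 - cum j.+1 t.
  have := logit_num_den_cumulative (f t) j.
  by rewrite f1 numE addrC => /(canRL (addrK _)).
(* Positivity of [f theta] is inherited from [q]: all numerator and denominator sums agree, so
   [logit_kernel] applies to the difference. *)
have fE : f theta = q.
  have sumB (S : pred 'I_(K + 1)) : \sum_(l | S l) (f theta - q) l 0 =
      \sum_(l | S l) f theta l 0 - \sum_(l | S l) q l 0.
    by rewrite -sumrB; apply: eq_bigr => l _; rewrite !mxE.
  apply/eqP; rewrite -subr_eq0; apply/eqP.
  apply: (@logit_kernel _ _ Defs.Cumulative _ _ q0) => [j|].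
    have nq := logit_num_gt0 Defs.Cumulative j q0.
    have dq := logit_den_gt0 Defs.Cumulative j q0.
    have qD := logit_num_den_cumulative q j; rewrite q1 in qD.
    have cq : cum j.+1 theta = logit_num Defs.Cumulative q j.
      rewrite cumE /eta -qE -ln_div ?posrE // lnK ?posrE ?divr_gt0 //.
      rewrite -[X in X + _](divff (lt0r_neq0 dq)) -mulrDl addrC qD mul1r invrK.
      by rewrite divfK // lt0r_neq0.
    have -> : logit_num Defs.Cumulative (f theta - q) j =
        logit_num Defs.Cumulative (f theta) j - logit_num Defs.Cumulative q j.
      exact: sumB.
    have -> : logit_den Defs.Cumulative (f theta - q) j =
        logit_den Defs.Cumulative (f theta) j - logit_den Defs.Cumulative q j.
      exact: sumB.
    have qB : 1 - logit_num Defs.Cumulative q j = logit_den Defs.Cumulative q j.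
      by rewrite -qD addrAC subrr add0r.
    by rewrite numE denE cq qB !subrr !mul0r.
  by rewrite sumB f1 q1 subrr.
exists f; split=> //.
have : \forall t \near theta, forall l, 0 < f t l 0.
  apply: (@filter_forall _ _ _ _ (nbhs_filter theta)) => l.
  apply: (cvgr_gt (f theta l 0)); last by rewrite fE.
  apply: (@differentiable_continuous _ _ _ theta (fun t => f t l 0)).
  exact: (differentiable_comp df (differentiable_coord _ _ _)).
apply: filterS => t ft0; apply/(model_probE _ _ _ X0); split => // j.
have e1 : 1 - expR (eta j t) / (1 + expR (eta j t)) = (1 + expR (eta j t))^-1.
  by rewrite -[X in X - _](divff (expD0 (eta j t))) -mulrBl addrK mul1r.
rewrite numE denE cumE e1 -ln_div ?posrE ?divr_gt0 ?invr_gt0 ?expR_gt0 //;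
  rewrite ?addr_gt0 ?expR_gt0 //.
by rewrite invrK divfK // expRK.
Qed.

End LocalSolution.

(** * Differentiating the model equation *)

Section ModelJacobian.
Context {R : realType} {K : nat} (lt : logit_type) (r : nat).

(** The model fixes [prob] only on [param_space], so that set is first shown to be a neighbourhood
    of [theta]. By uniqueness [prob i] then agrees near [theta] with the differentiable local
    solution. *)
Lemma model_prob_near (m : nat) (X : 'I_m -> 'M[R]_(K + 1, r))
    (prob : 'I_m -> 'cV[R]_r -> 'cV[R]_(K + 1)) (theta : 'cV[R]_r) :
  (forall i, dsubmx (X i) = 0) ->
  (forall t, param_space lt X t -> forall i, model_prob lt (X i) t (prob i t)) ->
  param_space lt X theta -> forall i,
  differentiable (prob i) theta /\
  \forall t \near theta, model_prob lt (X i) t (prob i t).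
Proof.
move=> X0 hprob htheta.
have solP i : exists f : 'cV[R]_r -> 'cV[R]_(K + 1),
    differentiable f theta /\ \forall t \near theta, model_prob lt (X i) t (f t).
  by apply: (local_solution (X0 i)) (hprob _ htheta i).
have nbhs_model : \forall t \near theta, param_space lt X t.
  apply: (@filter_forall _ _ _ _ (nbhs_filter theta)) => i.
  have [f [_ ft]] := solP i.
  by apply: filterS ft => t ft; exists (f t).
have near_model i : \forall t \near theta, model_prob lt (X i) t (prob i t).
  by apply: filterS nbhs_model => t /hprob.
move=> i; split=> //; have [f [df ft]] := solP i.
apply: near_eq_differentiable df.
apply: filterS2 ft (near_model i) => t ft pt.
exact: model_prob_inj (X0 i) ft pt.
Qed.

Lemma jacobian_col_sum (f : 'cV[R]_r -> 'cV[R]_(K + 1)) (theta : 'cV[R]_r) k :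
  differentiable f theta -> (\forall t \near theta, \sum_l f t l 0 = 1) ->
  \sum_l jacobian_mx f theta l k = 0.
Proof.
move=> df f1; under eq_bigr do rewrite mxE.
rewrite -derive_bigsum => [|l _]; last first.
  exact: (differentiable_comp df (differentiable_coord _ _ _)).
transitivity ('D_(delta_mx k 0) (cst (1 : R)) theta); last exact: derive_cst.
exact: near_eq_derive.
Qed.

(** Each logit equation is differentiated along coordinate k: logarithmic derivatives on the left,
    an entry of [X] on the right. The last row expresses that the total stays 1. *)
Lemma model_jacobian (X : 'M[R]_(K + 1, r)) (f : 'cV[R]_r -> 'cV[R]_(K + 1))
    (theta : 'cV[R]_r) :
  dsubmx X = 0 -> differentiable f theta ->
  (\forall t \near theta, model_prob lt X t (f t)) ->
  CDL lt (f theta) *m jacobian_mx f theta = X.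
Proof.
move=> X0 df near_f.
have dfl l : differentiable (fun t => f t l 0) theta.
  exact: (differentiable_comp df (differentiable_coord _ _ _)).
have near_fE : \forall t \near theta, [/\ forall l, 0 < f t l 0,
    \sum_l f t l 0 = 1 &
    forall j, ln (logit_num lt (f t) j) - ln (logit_den lt (f t) j) =
      (X *m t) (lshift 1 j) 0].
  by apply: filterS near_f => t /(model_probE _ _ _ X0).
have [f0 f1 _] := nbhs_singleton near_fE.
rewrite CDL_mul // -[RHS]vsubmxK X0; congr col_mx; apply/matrixP => j k; last first.
  rewrite [LHS]mxE jacobian_col_sum // ?mul0r ?mxE //.
  by apply: filterS near_fE => t [].
rewrite !mxE -(derive_mulmx_coord X (lshift 1 j) k theta).
have dnum : differentiable (fun t => logit_num lt (f t) j) theta.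
  exact: differentiable_bigsum.
have dden : differentiable (fun t => logit_den lt (f t) j) theta.
  exact: differentiable_bigsum.
have num0 := logit_num_gt0 lt j f0; have den0 := logit_den_gt0 lt j f0.
have -> : logit_num lt (col k (jacobian_mx f theta)) j =
    'D_(delta_mx k 0) (fun t => logit_num lt (f t) j) theta.
  rewrite derive_bigsum //; apply: eq_bigr => l _; by rewrite !mxE.
have -> : logit_den lt (col k (jacobian_mx f theta)) j =
    'D_(delta_mx k 0) (fun t => logit_den lt (f t) j) theta.
  rewrite derive_bigsum //; apply: eq_bigr => l _; by rewrite !mxE.
rewrite -!derive_ln // -deriveB; last 2 first.
- exact/diff_derivable/differentiable_ln.
- exact/diff_derivable/differentiable_ln.
apply: near_eq_derive; apply: filterS near_fE => t [_ _]; exact.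
Qed.

End ModelJacobian.

(** * Log-likelihood and score *)

Lemma ln_prod (R : realType) (I : finType) (P : pred I) (F : I -> R) :
  (forall i, P i -> 0 < F i) ->
  ln (\prod_(i | P i) F i) = \sum_(i | P i) ln (F i).
Proof.
move=> F0; suff [] : 0 < \prod_(i | P i) F i /\
    ln (\prod_(i | P i) F i) = \sum_(i | P i) ln (F i) by [].
apply: (big_ind2 (fun x y : R => 0 < x /\ ln x = y)) => [|x1 x2 y1 y2|i Pi].
- by rewrite ltr01 ln1.
- by move=> [x1_gt0 <-] [y1_gt0 <-]; rewrite mulr_gt0 // lnM.
- by rewrite F0.
Qed.

Section LogLikelihood.
Context {R : realType} {J r m : nat}.

Lemma multinomial_pmf_gt0 (N : nat) (q : 'cV[R]_J) (y : 'I_J -> nat) :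
  (forall j, 0 < q j 0) -> (\sum_j y j)%N = N -> 0 < multinomial_pmf N q y.
Proof.
move=> q0 yN; rewrite /multinomial_pmf yN eqxx mulr_gt0 //.
  by rewrite divr_gt0 ?ltr0n ?fact_gt0 // prodr_gt0 // => j _; rewrite ltr0n fact_gt0.
by apply: prodr_gt0 => j _; apply: exprn_gt0.
Qed.

Context (n : 'I_m -> nat) (prob : 'I_m -> 'cV[R]_r -> 'cV[R]_J).
Context (theta : 'cV[R]_r).
Hypothesis dprob : forall i, differentiable (prob i) theta.
Hypothesis prob0 : \forall t \near theta, forall i j, 0 < prob i t j 0.

Let good (y : 'I_m -> 'I_J -> nat) :=
  forall i, (0 < n i)%N -> (\sum_j y i j)%N = n i.

Let dpr i j : differentiable (fun t => prob i t j 0) theta.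
Proof. exact: (differentiable_comp (@dprob i) (differentiable_coord _ _ _)). Qed.

(** A wrong total makes one factor of the likelihood 0 at every parameter, and [ln 0] is 0 by
    convention. *)
Lemma loglik_bad y : ~ good y -> loglik n prob y = cst 0.
Proof.
move=> /existsNP[i /not_implyP[ni yi]]; apply/funext => t.
rewrite /loglik (bigD1 i) //= /multinomial_pmf.
by have /negbTE -> := introN eqP yi; rewrite mul0r ln0.
Qed.

(** The constant [c] collects the logarithms of the multinomial coefficients. The identity is local
    because positivity of the probabilities is given only near [theta]. *)
Lemma near_loglik y : good y -> exists c : R, \forall t \near theta,
  loglik n prob y t =
  c + \sum_(i | (0 < n i)%N) \sum_j (y i j)%:R * ln (prob i t j 0).
Proof.
move=> gy; pose c i : R := (n i)`!%:R / (\prod_j ((y i j)`!)%:R).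
have c0 i : 0 < c i.
  by rewrite divr_gt0 ?ltr0n ?fact_gt0 // prodr_gt0 // => j _; rewrite ltr0n fact_gt0.
exists (\sum_(i | (0 < n i)%N) ln (c i)); apply: filterS prob0 => t t0.
rewrite /loglik.
rewrite ln_prod => [|i ni]; last by apply: multinomial_pmf_gt0 => //; apply: gy.
rewrite -big_split; apply: eq_bigr => i ni /=.
rewrite /multinomial_pmf gy // eqxx lnM ?posrE; last 2 first.
- exact: c0.
- by apply: prodr_gt0 => j _; apply: exprn_gt0.
congr (_ + _); rewrite ln_prod => [|j _]; last exact: exprn_gt0.
by apply: eq_bigr => j _; rewrite lnXn // mulr_natl.
Qed.

Lemma differentiable_loglik y : differentiable (loglik n prob y) theta.
Proof.
have [gy|/loglik_bad ->] := pselect (good y); last exact: differentiable_cst.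
have t0 := nbhs_singleton prob0.
have [c near_c] := near_loglik gy.
suff : differentiable (fun t => c +
    \sum_(i | (0 < n i)%N) \sum_j (y i j)%:R * ln (prob i t j 0)) theta.
  by apply: near_eq_differentiable; apply: filterS near_c => t /esym.
apply: (@differentiableD _ _ _ (cst c)) => //.
apply: differentiable_bigsum => i ni; apply: differentiable_bigsum => j _.
by apply: (@differentiableM _ _ (cst _)) => //; apply: differentiable_ln.
Qed.

Lemma gradient_loglik_bad y : ~ good y -> gradient (loglik n prob y) theta = 0.
Proof.
by move=> /loglik_bad ->; apply/colP => k; rewrite !mxE derive_cst.
Qed.

Lemma gradient_loglik y k : good y -> gradient (loglik n prob y) theta k 0 =
  \sum_(i | (0 < n i)%N) \sum_j
    (y i j)%:R * (jacobian_mx (prob i) theta j k / prob i theta j 0).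
Proof.
move=> gy; have t0 := nbhs_singleton prob0.
have [c near_c] := near_loglik gy; rewrite mxE (near_eq_derive _ near_c).
have dterm i j : differentiable (fun t => (y i j)%:R * ln (prob i t j 0)) theta.
  by apply: (@differentiableM _ _ (cst _)) => //; apply: differentiable_ln.
have dsum i : differentiable
    (fun t => \sum_j (y i j)%:R * ln (prob i t j 0)) theta.
  exact: differentiable_bigsum.
rewrite [LHS](deriveD (f := cst c)); last 2 first.
- exact: derivable_cst.
- by apply: diff_derivable; apply: differentiable_bigsum.
rewrite derive_cst add0r derive_bigsum //; apply: eq_bigr => i ni.
rewrite derive_bigsum //; apply: eq_bigr => j _.
rewrite [LHS]deriveZ; last exact/diff_derivable/differentiable_ln.
by rewrite derive_ln // mxE.
Qed.

End LogLikelihood.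

(** * Multinomial moments *)

(** Bounded entries make the type of count vectors finite, so expectations become finite sums;
    [counts] forgets the bound. *)
Definition counts {J N : nat} (y : {ffun 'I_J -> 'I_N.+1}) : 'I_J -> nat :=
  fun j => y j.

Section MultinomialMoments.
Context {R : realType} {J : nat}.
Implicit Types (q : 'cV[R]_J) (y z : 'I_J -> nat) (g : ('I_J -> nat) -> R).

Definition incr_count (j : 'I_J) y : 'I_J -> nat := fun k => (y k + (k == j))%N.
(** The subtraction is truncated, so [incr_count j] restores [y] only when [y j] is positive. *)
Definition decr_count (j : 'I_J) y : 'I_J -> nat := fun k => (y k - (k == j))%N.

(* The expectation of [g] of the counts of [n] independent trials. *)
Fixpoint multinomial_sum q (n : nat) g : R :=
  if n is n'.+1 then
    \sum_j q j 0 * multinomial_sum q n' (fun y => g (incr_count j y))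
  else g (fun=> 0%N).

Lemma incr_decr_count j y : (0 < y j)%N -> incr_count j (decr_count j y) = y.
Proof.
move=> yj; apply/funext => k; rewrite /incr_count /decr_count subnK //.
by case: eqP => // ->.
Qed.

Lemma decr_incr_count j y : decr_count j (incr_count j y) = y.
Proof. by apply/funext => k; rewrite /incr_count /decr_count addnK. Qed.

Lemma sum_incr_count j y : (\sum_k incr_count j y k = (\sum_k y k).+1)%N.
Proof.
rewrite big_split -addn1; congr (_ + _)%N.
by rewrite (bigD1 j) //= eqxx big1 // => k /negbTE ->.
Qed.

(** Conditioning on the category j of one of the n + 1 trials. *)
Lemma multinomial_pmfS q n y :
  multinomial_pmf n.+1 q y =
  \sum_(j | (0 < y j)%N) q j 0 * multinomial_pmf n q (decr_count j y).
Proof.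
have sumE j : (0 < y j)%N ->
    (\sum_k decr_count j y k == n)%N = (\sum_k y k == n.+1)%N.
  by move=> yj; rewrite -[in RHS](incr_decr_count yj) sum_incr_count.
rewrite {1}/multinomial_pmf; case: ifPn => [/eqP yn|yn]; last first.
  rewrite big1 // => j yj; rewrite /multinomial_pmf sumE // (negbTE yn).
  by rewrite mulr0.
(* The mass with n! in place of (n + 1)!. The term of index j is c times [y j], and the counts sum
   to n + 1. *)
pose c : R := n`!%:R / (\prod_j ((y j)`!)%:R) * \prod_j q j 0 ^+ y j.
have stepE j : (0 < y j)%N ->
    q j 0 * multinomial_pmf n q (decr_count j y) = c * (y j)%:R.
  move=> yj; rewrite /multinomial_pmf sumE // yn eqxx /c.
  rewrite [in RHS](bigD1 j) //= [X in _ = _ / _ * X * _](bigD1 j) //=.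
  rewrite [in LHS](bigD1 j) //= [X in _ * (_ / _ * X) = _](bigD1 j) //=.
  rewrite {1 3}/decr_count eqxx subn1.
  have -> : \prod_(i < J | i != j) (((decr_count j y i)`!)%:R : R) =
      \prod_(i < J | i != j) ((y i)`!)%:R.
    by apply: eq_bigr => i ij; rewrite /decr_count (negbTE ij) subn0.
  have -> : \prod_(i < J | i != j) q i 0 ^+ decr_count j y i =
      \prod_(i < J | i != j) q i 0 ^+ y i.
    by apply: eq_bigr => i ij; rewrite /decr_count (negbTE ij) subn0.
  case: (y j) yj => // k _ /=; rewrite factS natrM exprS.
  set A := \prod_(i < J | _) _; set B := \prod_(i < J | _) _.
  have A0 : A != 0.
    by apply/prodf_neq0 => i _; rewrite pnatr_eq0 -lt0n fact_gt0.
  have k0 : (k`!)%:R != 0 :> R by rewrite pnatr_eq0 -lt0n fact_gt0.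
  have k1 : k.+1%:R != 0 :> R by rewrite pnatr_eq0.
  by field; rewrite nat1r k1 k0 A0.
rewrite (eq_bigr _ stepE) -mulr_sumr.
have -> : \sum_(j | (0 < y j)%N) ((y j)%:R : R) = n.+1%:R.
  rewrite -yn natr_sum [RHS](bigID (fun j => 0 < y j)%N) /= [X in _ + X]big1 ?addr0 //.
  by move=> j; rewrite -eqn0Ngt => /eqP ->.
by rewrite factS natrM /c; ring.
Qed.

Lemma eq_multinomial_sum q n g g' :
  (forall y, (\sum_j y j = n)%N -> g y = g' y) ->
  multinomial_sum q n g = multinomial_sum q n g'.
Proof.
elim: n g g' => [|n IH] g g' gE /=; first by rewrite gE // big1.
apply: eq_bigr => j _; congr (_ * _); apply: IH => y yn.
by rewrite gE // sum_incr_count yn.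
Qed.

Lemma multinomial_sum_linear q n (I : Type) (s : seq I) (c : I -> R)
    (g : I -> ('I_J -> nat) -> R) :
  multinomial_sum q n (fun y => \sum_(i <- s) c i * g i y) =
  \sum_(i <- s) c i * multinomial_sum q n (g i).
Proof.
elim: n g => // n IH g /=; under eq_bigr do rewrite IH mulr_sumr.
rewrite exchange_big; apply: eq_bigr => i _; rewrite mulr_sumr.
by apply: eq_bigr => j _; rewrite mulrCA.
Qed.

Lemma multinomial_sumD q n g g' :
  multinomial_sum q n (fun y => g y + g' y) =
  multinomial_sum q n g + multinomial_sum q n g'.
Proof.
elim: n g g' => // n IH g g' /=; rewrite -big_split; apply: eq_bigr => j _ /=.
by rewrite IH mulrDr.
Qed.

Lemma multinomial_sumZ q n c g :
  multinomial_sum q n (fun y => c * g y) = c * multinomial_sum q n g.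
Proof.
elim: n g => // n IH g /=; rewrite mulr_sumr; apply: eq_bigr => j _ /=.
by rewrite IH mulrCA.
Qed.

(** Ties the trial-by-trial recursion to the closed formula, which satisfies the same recursion by
    [multinomial_pmfS]. *)
Lemma multinomial_sum_indic q n y :
  multinomial_sum q n (fun z => [forall j, z j == y j]%:R) = multinomial_pmf n q y.
Proof.
elim: n y => [|n IH] y /=.
  rewrite /multinomial_pmf sum_nat_eq0 (eq_forallb (fun j => eq_sym _ _)).
  case: ifPn => // /forallP y0.
  by rewrite !big1 ?divr1 ?fact0 ?mulr1 // => j _; rewrite (eqP (y0 j)).
rewrite multinomial_pmfS [RHS]big_mkcond; apply: eq_bigr => j _.
case: ifPn => yj.
  rewrite -IH; congr (_ * _); apply: eq_multinomial_sum => z _; congr ((nat_of_bool _)%:R).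
  apply/eqfunP/eqfunP => [zy|zy] k.
    by rewrite -(decr_incr_count j z) /decr_count zy.
  by rewrite /incr_count zy -[in RHS](incr_decr_count yj).
(* If [y j] is 0, no vector becomes [y] by adding a count in j. The zero function is written [0 * 0]
   to fit [multinomial_sumZ]. *)
rewrite (@eq_multinomial_sum _ _ _ (fun=> 0 * 0)) ?multinomial_sumZ ?mul0r ?mulr0 //.
move=> z _; case: eqfunP => // /(_ j).
by rewrite /incr_count eqxx addn1 => zy; rewrite -zy in yj.
Qed.

(** Expands [g] in indicators of count vectors. Any bound N >= n is allowed, so that settings with
    different totals can share one finite type. *)
Lemma multinomial_sumE q n N g : (n <= N)%N ->
  multinomial_sum q n g =
  \sum_(y : {ffun 'I_J -> 'I_N.+1}) multinomial_pmf n q (counts y) * g (counts y).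
Proof.
move=> nN; under eq_bigr do rewrite -multinomial_sum_indic mulrC.
rewrite -multinomial_sum_linear; apply: eq_multinomial_sum => y yn.
have yN j : (y j < N.+1)%N.
  by rewrite ltnS (leq_trans _ nN) // -yn (bigD1 j) //= leq_addr.
pose y' : {ffun 'I_J -> 'I_N.+1} := [ffun j => Ordinal (yN j)].
have y'E : counts y' = y by apply/funext => j; rewrite /counts ffunE.
rewrite (bigD1 y') //= big1 ?addr0 => [|z zy].
  rewrite y'E; case: eqfunP => [_|[] //]; by rewrite mulr1.
case: eqfunP => [yz|_]; last by rewrite mulr0.
by case/eqP: zy; apply/ffunP => j; apply: val_inj; rewrite ffunE /= yz.
Qed.

Definition linear_stat (a : 'I_J -> R) y : R := \sum_j (y j)%:R * a j.

Lemma linear_stat_incr a j y :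
  linear_stat a (incr_count j y) = linear_stat a y + a j.
Proof.
rewrite /linear_stat; under eq_bigr do rewrite natrD mulrDl.
rewrite big_split /=; congr (_ + _).
by rewrite (bigD1 j) //= eqxx mul1r big1 ?addr0 // => k /negbTE ->; rewrite mul0r.
Qed.

Context (q : 'cV[R]_J).
Hypothesis q1 : \sum_j q j 0 = 1.

Lemma multinomial_sum_cst n c : multinomial_sum q n (fun=> c) = c.
Proof. by elim: n => //= n IH; rewrite -mulr_suml q1 mul1r. Qed.

Lemma multinomial_mean n a : \sum_j q j 0 * a j = 0 ->
  multinomial_sum q n (linear_stat a) = 0.
Proof.
move=> qa; elim: n => [|n IH] /=.
  by rewrite /linear_stat big1 // => j _; rewrite mul0r.
rewrite -[RHS]qa; apply: eq_bigr => j _; congr (_ * _).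
under [X in multinomial_sum _ _ X]eq_fun do rewrite linear_stat_incr.
by rewrite multinomial_sumD IH add0r multinomial_sum_cst.
Qed.

(** One more trial in category j adds [a j] and [b j] to the two statistics; the cross terms have
    mean 0 and only the mean of [a j * b j] is added. *)
Lemma multinomial_cov n a b :
  \sum_j q j 0 * a j = 0 -> \sum_j q j 0 * b j = 0 ->
  multinomial_sum q n (fun y => linear_stat a y * linear_stat b y) =
  n%:R * \sum_j q j 0 * (a j * b j).
Proof.
move=> qa qb; elim: n => [|n IH] /=.
  by rewrite mul0r /linear_stat big1 ?mul0r // => j _; rewrite mul0r.
rewrite -natr1 mulrDl mul1r -{}IH -[X in X + _]mul1r -q1 mulr_suml -big_split /=.
apply: eq_bigr => j _; rewrite -mulrDr; congr (_ * _).
under [X in multinomial_sum _ _ X]eq_fun do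
  rewrite !linear_stat_incr mulrDl !mulrDr [_ * b j]mulrC.
rewrite !multinomial_sumD !multinomial_sumZ !multinomial_mean //.
by rewrite multinomial_sum_cst !mulr0 addr0 add0r.
Qed.

End MultinomialMoments.

(** * Moments of independent multinomial vectors *)

Section ProductMultinomialMoments.
Context {R : realType} {J m N : nat} (n : 'I_m -> nat) (q : 'I_m -> 'cV[R]_J).
Hypothesis nN : forall i, (n i <= N)%N.
Hypothesis q1 : forall i, \sum_j q i j 0 = 1.

Local Notation table := {ffun 'I_m -> {ffun 'I_J -> 'I_N.+1}}.

Definition product_pmf (c : table) : R :=
  \prod_i multinomial_pmf (n i) (q i) (counts (c i)).

(** Independence in finite form: by distributivity, the expectation of a product with one factor per
    setting factorises. *)
Lemma product_pmf_sum (G : 'I_m -> ('I_J -> nat) -> R) :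
  \sum_(c : table) product_pmf c * \prod_i G i (counts (c i)) =
  \prod_i multinomial_sum (q i) (n i) (G i).
Proof.
rewrite [RHS](eq_bigr _ (fun i _ => multinomial_sumE (q i) (G i) (nN i))).
by rewrite bigA_distr_bigA; apply: eq_bigr => c _; rewrite -big_split.
Qed.

Lemma product_mean (a : 'I_m -> 'I_J -> R) :
  (forall i, \sum_j q i j 0 * a i j = 0) ->
  \sum_(c : table) product_pmf c * \sum_i linear_stat (a i) (counts (c i)) = 0.
Proof.
move=> qa; under eq_bigr do rewrite mulr_sumr.
rewrite exchange_big big1 // => i0 _ /=.
(* A single summand becomes a product whose factors are 1 away from [i0]; the factor at [i0] has
   mean 0. *)
pose G i := if i == i0 then linear_stat (a i) else fun=> 1.
under eq_bigr => c _.
  have -> : linear_stat (a i0) (counts (c i0)) = \prod_i G i (counts (c i)).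
    rewrite (bigD1 i0) //= {1}/G eqxx big1 ?mulr1 // => i /negbTE.
    by rewrite /G => ->.
  over.
by rewrite product_pmf_sum (bigD1 i0) //= {1}/G eqxx multinomial_mean ?mul0r.
Qed.

Lemma product_cov (a b : 'I_m -> 'I_J -> R) :
  (forall i, \sum_j q i j 0 * a i j = 0) ->
  (forall i, \sum_j q i j 0 * b i j = 0) ->
  \sum_(c : table) product_pmf c *
    ((\sum_i linear_stat (a i) (counts (c i))) *
     (\sum_i linear_stat (b i) (counts (c i)))) =
  \sum_i (n i)%:R * \sum_j q i j 0 * (a i j * b i j).
Proof.
move=> qa qb; under eq_bigr do rewrite mulr_suml mulr_sumr.
rewrite exchange_big; apply: eq_bigr => i0 _ /=.
under eq_bigr do rewrite !mulr_sumr.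
rewrite exchange_big /=.
(* Two separate tests let one product cover both i0 = i1 and i0 <> i1. *)
pose G i1 i y := (if i == i0 then linear_stat (a i) y else 1) *
                 (if i == i1 then linear_stat (b i) y else 1).
have termE i1 : \sum_(c : table) product_pmf c *
      (linear_stat (a i0) (counts (c i0)) * linear_stat (b i1) (counts (c i1))) =
    \prod_i multinomial_sum (q i) (n i) (G i1 i).
  rewrite -product_pmf_sum; apply: eq_bigr => c _; congr (_ * _).
  rewrite big_split /= -!big_mkcond /=.
  by rewrite !big_pred1_eq.
under eq_bigr do rewrite termE.
(* Off the diagonal the factor at [i0] is the mean of a centred statistic, so the term vanishes. *)
rewrite (bigD1 i0) //= [X in _ + X]big1 ?addr0 => [|i1 i10]; last first.
  rewrite (bigD1 i0) //= (@eq_multinomial_sum _ _ _ _ _ (linear_stat (a i0))).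
    by rewrite multinomial_mean ?mul0r.
  by move=> y _; rewrite /G eqxx eq_sym (negbTE i10) mulr1.
rewrite (bigD1 i0) //= [X in _ * X]big1 ?mulr1 => [|i /negbTE ii0].
  rewrite -multinomial_cov //; apply: eq_multinomial_sum => y _.
  by rewrite /G eqxx.
rewrite (@eq_multinomial_sum _ _ _ _ _ (fun=> 1)) ?multinomial_sum_cst //.
by move=> y _; rewrite /G ii0 mulr1.
Qed.

End ProductMultinomialMoments.

(** * Covariance of the score *)

Section ScoreCovariance.
Context {disp : measure_display} {T : measurableType disp} {R : realType}.
Context (P : probability T R) {J m : nat}.
Context (n : 'I_m -> nat) (q : 'I_m -> 'cV[R]_J).
Context (Y : 'I_m -> 'I_J -> T -> nat).
Hypothesis mY : forall i j v, measurable [set w | Y i j w = v].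
Hypothesis hY : forall i, (0 < n i)%N -> multinomial_law P (n i) (q i) (Y i).
Hypothesis hindep : indep_counts P [set i | (0 < n i)%N]%SET Y.
Hypothesis q1 : forall i, \sum_j q i j 0 = 1.

Let N := (\sum_i n i)%N.
Local Notation table := {ffun 'I_m -> {ffun 'I_J -> 'I_N.+1}}.

Let nN i : (n i <= N)%N.
Proof. by rewrite /N (bigD1 i) //= leq_addr. Qed.

(** A setting with n i = 0 must have a zero row. As [event] constrains only the observed settings,
    this makes the table of an outcome unique. *)
Let valid (c : table) : bool := [forall i, (\sum_j counts (c i) j == n i)%N].

Let event (c : table) : set T :=
  [set w | forall i, (0 < n i)%N -> (fun j => Y i j w) = counts (c i)].

Let table_stat (H : table -> R) (w : T) : R :=
  \sum_(c | valid c) H c * \1_(event c) w.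

Let measurable_event c : measurable (event c).
Proof.
have -> : event c = \bigcap_(i in [set i | (0 < n i)%N])
    \bigcap_(j in [set: 'I_J]) [set w | Y i j w = counts (c i) j].
  apply/seteqP; split=> w /= wc i ni.
    by move=> j _ /=; rewrite -(wc i ni).
  by apply/funext => j; apply: wc.
apply: fin_bigcap_measurable; first exact: finite_finset.
move=> i _; apply: fin_bigcap_measurable => [|j _]; first exact: finite_finset.
exact: mY.
Qed.

Let prob_event c : valid c -> P (event c) = (product_pmf n q c)%:E.
Proof.
move=> /forallP vc.
have := hindep (subxx _) (fun i => [set y | y = counts (c i)]).
rewrite (_ : [set w | _] = event c) => [->|]; last first.
  by apply/seteqP; split=> w /= wc i; have := wc i; rewrite inE.
rewrite /product_pmf -prodEFin [RHS](bigID (fun i => 0 < n i)%N) /=.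
rewrite [X in (_ * X)%E]big1 ?mule1 => [|i].
  apply: eq_big => [i|i]; rewrite inE // => ni.
  rewrite -(hY ni); congr (P _); apply/seteqP; split=> w /=.
    by move=> wc j; rewrite -wc.
  by move=> wc; apply/funext.
(* An unobserved setting contributes the factor 1, the mass of the zero vector for 0 trials. *)
rewrite -eqn0Ngt => ni; rewrite /multinomial_pmf vc (eqP ni).
have c0 j : counts (c i) j = 0%N.
  by have := vc i; rewrite (eqP ni) sum_nat_eq0 => /forallP/(_ j)/eqP.
by rewrite !big1 ?divr1 ?mulr1 // => j _; rewrite c0.
Qed.

Let product_pmf_invalid c : ~~ valid c -> product_pmf n q c = 0.
Proof.
move=> /forallPn[i ci]; rewrite /product_pmf (bigD1 i) //=.
by rewrite /multinomial_pmf (negbTE ci) mul0r.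
Qed.

(** Linearity over the indicators. Invalid tables have mass 0, so the sum extends to all tables as
    the product formulas require. *)
Let expectation_table_stat H :
  ('E_P[table_stat H] = (\sum_(c : table) product_pmf n q c * H c)%:E)%E.
Proof.
rewrite unlock; under eq_integral do rewrite /table_stat -sumEFin.
rewrite integral_sum // => [|c]; last first.
  under eq_fun do rewrite EFinM.
  by apply: integrableZl => //; apply: integrable_indic.
rewrite -sumEFin [RHS](bigID valid) /= [X in (_ + X)%E]big1 ?adde0; last first.
  by move=> c /product_pmf_invalid ->; rewrite mul0r.
apply: eq_bigr => c vc; under eq_integral do rewrite EFinM.
rewrite integralZl //; last exact: integrable_indic.
by rewrite integral_indic // setIT [X in (_ * X)%E](prob_event vc) -EFinM mulrC.
Qed.

Let table_exists w :
  (forall i, (0 < n i)%N -> (\sum_j Y i j w)%N = n i) ->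
  exists c : table, [/\ valid c, event c w &
    forall c', valid c' -> event c' w -> c' = c].
Proof.
move=> wn.
(* The table is read off from the outcome, with 0 at unobserved settings; [inord] keeps each entry
   because counts are at most N. *)
pose c : table :=
  [ffun i => [ffun j => inord (if (0 < n i)%N then Y i j w else 0%N)]].
have cE i j : counts (c i) j = (if (0 < n i)%N then Y i j w else 0%N).
  rewrite /counts !ffunE inordK //; case: ifP => // ni.
  rewrite ltnS (leq_trans _ (nN i)) // -(wn i ni) (bigD1 j) //= leq_addr //.
exists c; split.
- apply/forallP => i; under eq_bigr do rewrite cE.
  case: (posnP (n i)) => [->|ni]; first by rewrite big1.
  by rewrite wn.
- by move=> i ni; apply/funext => j; rewrite cE ni.
move=> c' /forallP vc' wc'; apply/ffunP => i; apply/ffunP => j.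
apply: val_inj; rewrite -[LHS]/(counts (c' i) j) -[RHS]/(counts (c i) j) cE.
case: ifPn => [ni|]; first by rewrite -(wc' i ni).
rewrite -eqn0Ngt => ni; have := vc' i.
by rewrite (eqP ni) sum_nat_eq0 => /forallP/(_ j)/eqP.
Qed.

Let event_good c w : valid c -> event c w ->
  forall i, (0 < n i)%N -> (\sum_j Y i j w)%N = n i.
Proof.
move=> /forallP vc wc i ni; rewrite -(eqP (vc i)).
by apply: eq_bigr => j _; rewrite -(wc i ni).
Qed.

Let table_statE H w c : valid c -> event c w -> table_stat H w = H c.
Proof.
move=> vc wc; have [c0 [vc0 wc0 c0P]] := table_exists (event_good vc wc).
rewrite /table_stat (bigD1 c) //= indicE mem_set // mulr1 big1 ?addr0 //.
move=> c' /andP[vc' /eqP c'c]; rewrite indicE memNset ?mulr0 // => wc'.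
by apply: c'c; rewrite (c0P _ vc' wc') (c0P _ vc wc).
Qed.

Let table_stat_bad H w :
  ~ (forall i, (0 < n i)%N -> (\sum_j Y i j w)%N = n i) -> table_stat H w = 0.
Proof.
move=> bad; rewrite /table_stat big1 // => c vc.
rewrite indicE memNset ?mulr0 // => wc; apply: bad; exact: event_good vc wc.
Qed.

(** At each outcome at most one indicator of a valid table is nonzero. *)
Let table_statM H H' w :
  table_stat H w * table_stat H' w = table_stat (fun c => H c * H' c) w.
Proof.
have [/table_exists[c [vc wc _]]|bad] :=
  pselect (forall i, (0 < n i)%N -> (\sum_j Y i j w)%N = n i).
  by rewrite !(table_statE _ vc wc).
by rewrite !table_stat_bad ?mulr0.
Qed.

(** [U] and [V] equal table statistics at every outcome, exceptional ones included. Both have mean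
    0, so the covariance is the expectation of a product, given by [product_cov]. *)
Lemma covariance_linear_stats (a b : 'I_m -> 'I_J -> R) (U V : T -> R) :
  (forall i, \sum_j q i j 0 * a i j = 0) ->
  (forall i, \sum_j q i j 0 * b i j = 0) ->
  (forall w, (forall i, (0 < n i)%N -> (\sum_j Y i j w)%N = n i) ->
     U w = \sum_(i | (0 < n i)%N) linear_stat (a i) (fun j => Y i j w) /\
     V w = \sum_(i | (0 < n i)%N) linear_stat (b i) (fun j => Y i j w)) ->
  (forall w, ~ (forall i, (0 < n i)%N -> (\sum_j Y i j w)%N = n i) ->
     U w = 0 /\ V w = 0) ->
  covariance P U V =
  (\sum_i (n i)%:R * \sum_j q i j 0 * (a i j * b i j))%:E.
Proof.
move=> qa qb good bad.
pose G (d : 'I_m -> 'I_J -> R) (c : table) :=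
  \sum_i linear_stat (d i) (counts (c i)).
have GE d c w : valid c -> event c w -> G d c =
    \sum_(i | (0 < n i)%N) linear_stat (d i) (fun j => Y i j w).
  move=> /forallP vc wc; rewrite /G (bigID (fun i => 0 < n i)%N) /=.
  (* Valid tables have zero rows at unobserved settings, so summing over all settings changes
     nothing. *)
  rewrite [X in _ + X]big1 ?addr0 => [|i].
    by apply: eq_bigr => i ni; rewrite wc.
  rewrite -eqn0Ngt => ni; have := vc i; rewrite (eqP ni) sum_nat_eq0 => /forallP c0.
  by rewrite /linear_stat big1 // => j _; rewrite (eqP (c0 j)) mul0r.
have statE d W :
    (forall w, (forall i, (0 < n i)%N -> (\sum_j Y i j w)%N = n i) ->
      W w = \sum_(i | (0 < n i)%N) linear_stat (d i) (fun j => Y i j w)) ->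
    (forall w, ~ (forall i, (0 < n i)%N -> (\sum_j Y i j w)%N = n i) -> W w = 0) ->
    W = table_stat (G d).
  move=> Wgood Wbad; apply/funext => w.
  have [gw|bw] := pselect (forall i, (0 < n i)%N -> (\sum_j Y i j w)%N = n i).
    have [c [vc wc _]] := table_exists gw.
    by rewrite (table_statE _ vc wc) Wgood // -(GE _ _ _ vc wc).
  by rewrite Wbad // table_stat_bad.
have UE : U = table_stat (G a) by apply: statE => w; [case/good | case/bad].
have VE : V = table_stat (G b) by apply: statE => w; [case/good | case/bad].
have mean0 d : (forall i, \sum_j q i j 0 * d i j = 0) ->
    ('E_P[table_stat (G d)] = 0)%E.
  by move=> qd; rewrite expectation_table_stat product_mean.
rewrite covariance.unlock UE VE !mean0 //=.
rewrite -(product_cov nN q1 qa qb) -expectation_table_stat; congr expectation.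
by apply/funext => w /=; rewrite -table_statM !fctE /= !subr0.
Qed.

End ScoreCovariance.

(** * The Fisher information matrix *)

Lemma FiE (R : realType) (J r : nat) (f : 'cV[R]_r -> 'cV[R]_J)
    (theta : 'cV[R]_r) k l : (forall j, 0 < f theta j 0) ->
  Fi f theta k l = \sum_j f theta j 0 *
    ((jacobian_mx f theta j k / f theta j 0) *
     (jacobian_mx f theta j l / f theta j 0)).
Proof.
move=> f0; rewrite /Fi invmx_diag => [|j]; last by rewrite mxE lt0r_neq0.
rewrite mul_mx_diag mxE; apply: eq_bigr => j _.
rewrite [X in X * _ = _]mxE [X in X * _ * _ = _]mxE.
rewrite [(\row_i _) _ _]mxE [_^T _ _]mxE.
have fj := lt0r_neq0 (f0 j); field.
exact: fj.
Qed.

Theorem theorem2p1 (R : realType) (d m K : nat)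
    (hd : (1 <= d)%N) (hm : (2 <= m)%N) (hK : (2 <= K + 1)%N)
    (x : 'I_m -> 'rV[R]_d) (hx : injective x)
    (n : 'I_m -> nat) (hn : (0 < \sum_i n i)%N)
    (lt : logit_type) (p : 'I_K -> nat) (pc : nat)
    (h : forall j : 'I_K, 'rV[R]_d -> 'cV[R]_(p j))
    (hc : 'rV[R]_d -> 'cV[R]_pc)
    (prob : 'I_m -> 'cV[R]_(\sum_j p j + pc) -> 'cV[R]_(K + 1))
    (hprob : forall t, param_space lt (fun i => Xmx h hc (x i)) t ->
       forall i, model_prob lt (Xmx h hc (x i)) t (prob i t))
    (theta : 'cV[R]_(\sum_j p j + pc))
    (htheta : param_space lt (fun i => Xmx h hc (x i)) theta)
    (disp : measure_display) (T : measurableType disp) (P : probability T R)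
    (Y : 'I_m -> 'I_(K + 1) -> {RV P >-> nat})
    (hY : forall i, (0 < n i)%N ->
       multinomial_law P (n i) (prob i theta) (fun j => Y i j))
    (hindep : indep_counts P [set i | (0 < n i)%N]%SET (fun i j => Y i j)) :
  [/\ forall i, CDL lt (prob i theta) \in unitmx,
      forall i, differentiable (prob i) theta,
      forall i, jacobian_mx (prob i) theta =
        invmx (CDL lt (prob i theta)) *m Xmx h hc (x i),
      forall y, differentiable (loglik n prob y) theta
    & fisher_information P n prob (fun i j => Y i j) theta =
        map_mx EFin (\sum_(i < m) (n i)%:R *: Fi (prob i) theta)].
Proof.
have X0 i : dsubmx (Xmx h hc (x i)) = 0 by rewrite /Xmx col_mxKd.
have near_model i := model_prob_near X0 hprob htheta i.
have near_pos : \forall t \near theta, forall i j, 0 < prob i t j 0.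
  apply: (@filter_forall _ _ _ _ (nbhs_filter theta)) => i.
  by have [_] := near_model i; apply: filterS => t [].
have near_sum1 i : \forall t \near theta, \sum_j prob i t j 0 = 1.
  by have [_] := near_model i; apply: filterS => t [].
have prob_gt0 := nbhs_singleton near_pos.
have dprob i : differentiable (prob i) theta by case: (near_model i).
have CDLu i : CDL lt (prob i theta) \in unitmx by apply: CDL_unitmx.
split=> //.
- move=> i; have [_ model_i] := near_model i.
  by rewrite -(model_jacobian (X0 i) (dprob i) model_i) mulKmx.
- by move=> y; apply: differentiable_loglik.
apply/matrixP => k l; rewrite mxE [RHS]mxE.
(* The score weight of category j at setting i is the logarithmic derivative of its probability; it
   is centred because the columns of the Jacobian sum to 0. *)
pose a k i j := jacobian_mx (prob i) theta j k / prob i theta j 0.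
have a0 k' i : \sum_j prob i theta j 0 * a k' i j = 0.
  rewrite -[RHS](jacobian_col_sum k' (dprob i) (near_sum1 i)).
  by apply: eq_bigr => j _; rewrite /a mulrC divfK // lt0r_neq0.
rewrite (@covariance_linear_stats _ _ _ P _ _ n (fun i => prob i theta)
  (fun i j => Y i j) _ hY hindep _ (a k) (a l)) //.
(* By [FiE], an entry of [Fi] is the single-trial covariance of two such weights. *)
- congr EFin; rewrite summxE; apply: eq_bigr => i _.
  by rewrite [RHS]mxE FiE.
- by move=> i j v; apply: (measurable_funPTI (Y i j) (Y := [set v])).
- by move=> i; apply: nbhs_singleton (near_sum1 i).
- by move=> w gw; rewrite /score !gradient_loglik.
- by move=> w bw; rewrite /score gradient_loglik_bad // !mxE.
Qed.
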